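(* Suppose Assumption (G) holds. Let $f^n\overset{D}{\to}f^\dagger$ in $Y$ as $n\to\infty$ and put $\delta_i^n=D_i(f_i^\dagger,f_i^n)$ for $i\in\{1,\dots,N\}$. Suppose that $\delta_i^n\sim(\delta^n)^{\mu_i}$ with a sequence $(\delta^n)_n$ in $(0,\infty)$, $\delta^n\to0$, and $\mu_i\ge1$. Let $\nu_i\in(0,1]$, define $\eta_i=\mu_i\nu_i$ and $\eta_{\min}=\min_i\eta_i$, and take one $i_0$ such that $\mu_{i_0}=\min\{\mu_i: \eta_i=\eta_{\min}\}$ and $\eta_{i_0}=\eta_{\min}$. Assume that $\nu_{i_0}<1$. Then, with $$\epsilon_i=\frac{\eta_{\min}}{\mu_i}\quad\text{for all }i,$$ it follows that $\epsilon_i\in(0,1)$. Moreover, let $\lambda^n\in(0,\infty)^N$ satisfy $$\lambda_i^n\sim(\delta_i^n)^{-(1-\epsilon_i)}\quad\text{for all }i,$$ let $(u^n)_n$ be a sequence of solutions to $\min_{u\in\operatorname{dom}(T)}J_{\lambda^n}(u,f^n)$ and let $u^\dagger$ be an $R$-minimizing solution of $Tu=f^\dagger$ such that, for some $n_0$, condition $S_2(U_{n_0},f^\dagger)$ holds, where $U_{n_0}=\{u^n: n\ge n_0\}\cup\{u^\dagger\}$, with functions $\psi_i$ satisfying $\psi_i(x)\sim x^{\nu_i}$. Then there is $C>0$ such that, for all but finitely many $n$, $$R(u^n)\le R(u^\dagger)+C(\delta^n)^{\eta_{\min}}.$$ If, further, there exist $\xi\in\partial R(u^\dagger)$ and constants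 $0<\beta_1<1$, $0<\beta_2$ such that $$-\langle\xi,u-u^\dagger\rangle\le\beta_1D_R^\xi(u,u^\dagger)+\beta_2\sum_{i=1}^ND_i(T_iu,T_iu^\dagger)$$ for all $u$ satisfying $R(u)+\sum_{i=1}^ND_i(T_iu,f_i^\dagger)\le R(u^\dagger)+\epsilon$ for some $\epsilon>0$, then for any $j\in\{1,\dots,N\}$ $$D_R^\xi(u^n,u^\dagger)=O\big((\delta^n)^{\eta_{\min}}\big),\qquad D_j(T_ju^n,f_j^n)=O\big((\delta^n)^{\mu_j}\big).$$ This choice of the $\epsilon_i$ is optimal for the upper bounds $$B^n(\lambda)=\sum_{i=1}^N\big(\lambda_i^n\delta_i^n+\psi_i(\delta_i^n)\big)\ \text{ for } D_R^\xi(u^n,u^\dagger),\qquad B_j^n(\lambda)=(\lambda_j^n)^{-1}\sum_{i=1}^N\big(\lambda_i^n\delta_i^n+\psi_i(\delta_i^n)\big)\ \text{ for } D_j(T_ju^n,f_j^n)$$ in the sense that they cannot be improved by any other parameter choice of the form $\tilde\lambda_i^n=(\delta_i^n)^{-(1-\tilde\epsilon_i)}$ with $\tilde\epsilon_i\in(0,1)$: for any such choice there is $c>0$ with $B^n(\tilde\lambda)\ge c(\delta^n)^{\eta_{\min}}$ and $B_j^n(\tilde\lambda)\ge c(\delta^n)^{\mu_j}$ for all $j$ and all $n$.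
   Context: Setting. Let $(X,\|\cdot\|_X)$ be a Banach space and $R\colon X\to[0,\infty]$. For $i=1,\dots,N$ let $(Y_i,\|\cdot\|_{Y_i})$ be a normed space, $D_i\colon Y_i\times Y_i\to[0,\infty]$ a data discrepancy and $T_i\colon \operatorname{dom}(T_i)\subset X\to Y_i$ an operator. Put $\operatorname{dom}(T)=\bigcap_{i=1}^N\operatorname{dom}(T_i)$, $Y=Y_1\times\cdots\times Y_N$ and $Tu=(T_1u,\dots,T_Nu)$. For $u\in\operatorname{dom}(T)$, $f\in Y$ and $\lambda\in(0,\infty)^N$ let $$J_\lambda(u,f)=\sum_{i=1}^N\lambda_iD_i(T_iu,f_i)+R(u).$$ An $R$-minimizing solution of $Tu=f^\dagger$ is a minimizer of $R$ over $\{u\in\operatorname{dom}(T):Tu=f^\dagger\}$ at which $R$ is finite. In expressions involving $T_iu$, $u$ ranges over $\operatorname{dom}(T)$. $\xi\in\partial R(u)\subset X^*$ means $R(u)<\infty$ and $R(v)\ge R(u)+\langle\xi,v-u\rangle$ for all $v\in X$; the Bregman distance is $D_R^\xi(v,u)=R(v)-R(u)-\langle\xi,v-u\rangle$. For sequences, $x^n\sim y^n$ means there are $c,C>0$ with $cy^n\le x^n\le Cy^n$ for all $n$; similarly $\psi_i(x)\sim x^{\nu_i}$ means $cx^{\nu_i}\le\psi_i(x)\le Cx^{\nu_i}$ for all $x\ge0$. $x^n=O(y^n)$ means there is $C>0$ with $x^n\le Cy^n$ for all sufficiently large $n$. Let $\tau_X$ be a Hausdorff topology on $X$, and for each $i$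 let $\tau_{Y_i}$ (Hausdorff) and $\tau_{D_i}$ (arbitrary) be topologies on $Y_i$. Write $f_i^n\overset{D_i}{\to}f_i$ if $D_i(f_i,f_i^n)\to0$ and $f_i^n\to f_i$ in $\tau_{D_i}$ as $n\to\infty$; $f^n\overset{D}{\to}f$ means this holds for every component. Assumption (G): (1) For each $i$ and $a,b\in Y_i$, $D_i(a,b)=0$ implies $a=b$. (2) For each $i$: if $a^n\to a$ in $\tau_{Y_i}$ and $f_i^n\overset{D_i}{\to}f_i$, then $D_i(a,f_i)\le\liminf_{n\to\infty}D_i(a^n,f_i^n)$. (3) $R$ is lower semi-continuous w.r.t. $\tau_X$. (4) Each $T_i$ is continuous from $(X,\tau_X)$ (on $\operatorname{dom}(T_i)$) to $(Y_i,\tau_{Y_i})$ and $\operatorname{dom}(T_i)$ is closed w.r.t. convergence in $\tau_X$. (5) For any $\lambda\in(0,\infty)^N$: whenever $f^n\overset{D}{\to}f$ and $J_\lambda(u^n,f^n)<c$ for all $n$ and some constant $c$, the sequence $(u^n)_n$ admits a $\tau_X$-convergent subsequence. Condition $S_2(U,f^\dagger)$ (for $U\subset\operatorname{dom}(T)$): for each $i$ there are a continuous increasing function $\psi_i\colon[0,\infty)\to[0,\infty)$ with $\psi_i(0)=0$, a set $V_i\in\tau_{D_i}$ with $f_i^\dagger\in V_i$, and $\alpha>0$ such that for each $v\in U$ and each $f_i\in V_i$ with $D_i(f_i^\dagger,f_i)<\alpha$, $$D_i(T_iv,f_i)\le D_i(T_iv,f_i^\dagger)\big(1+\psi_i(D_i(f_i^\dagger,f_i))\big)+\psi_i(D_i(f_i^\dagger,f_i)),$$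 $$D_i(T_iv,f_i)\ge D_i(T_iv,f_i^\dagger)\big(1-\psi_i(D_i(f_i^\dagger,f_i))\big)-\psi_i(D_i(f_i^\dagger,f_i)).$$ *)

(* Defs.v *)
From HB Require Import structures.
From mathcomp Require Import all_boot all_order all_algebra.
From mathcomp Require Import all_classical all_reals all_analysis.

Set Implicit Arguments.
Unset Strict Implicit.
Unset Printing Implicit Defensive.

Import Order.TTheory GRing.Theory Num.Theory.
Import numFieldNormedType.Exports.

Local Open Scope classical_set_scope.
Local Open Scope ring_scope.

(* The normed spaces X and Y_i carry further topologies, unrelated to the norm
   ones. Such a topology is a family of open sets [tau]; [topo tau] is the
   carrier seen as a [topologicalType] with that family of open sets. *)
Record topology (T : Type) := Topology {
  is_open :> set T -> Prop;
  is_openT : is_open setT;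
  is_openI : setI_closed is_open;
  is_open_bigcup : forall S : set (set T),
    S `<=` is_open -> is_open (\bigcup_(V in S) V) }.

Definition topo (T : choiceType) (tau : topology T) : Type := T.

Section topo_instance.
Context (T : choiceType) (tau : topology T).

Let topo_bigU (I : Type) (f : I -> set (topo tau)) :
  (forall i, tau (f i)) -> tau (\bigcup_i f i).
Proof.
move=> tauf; rewrite -(bigcup_image setT f id).
by apply: is_open_bigcup => _ [i _ <-]; exact: tauf.
Qed.

HB.instance Definition _ := Choice.copy (topo tau) T.
HB.instance Definition _ := isOpenTopological.Build (topo tau)
  (is_openT tau) (@is_openI _ tau) topo_bigU.

Lemma open_topoE (V : set (topo tau)) : open V = tau V.
Proof. by []. Qed.

End topo_instance.

Definition cvg_in (T : choiceType) (tau : topology T) (u : nat -> T) (l : T) :=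
  (u : nat -> topo tau) @ \oo --> (l : topo tau).

Section asymptotics.
Context {R : realType}.

Definition is_minimum (A : set R) (m : R) := A m /\ lbound A m.

Definition seq_sim (x y : nat -> R) := exists c C : R,
  [/\ 0 < c, 0 < C & forall n, c * y n <= x n <= C * y n].

Definition sim_power (psi : R -> R) (nu : R) := exists c C : R,
  [/\ 0 < c, 0 < C &
      forall x, 0 <= x -> c * x `^ nu <= psi x <= C * x `^ nu].

Definition seq_bigO (x : nat -> \bar R) (y : nat -> R) :=
  exists2 C : R, 0 < C & \forall n \near \oo, (x n <= (C * y n)%:E)%E.

(* "increasing" is understood in the weak sense *)
Definition modulus (psi : R -> R) :=
  [/\ {within `[0, +oo[%classic, continuous psi},
      {in `[0, +oo[ &, {homo psi : x y / x <= y}},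
      forall x, 0 <= x -> 0 <= psi x & psi 0 = 0].

End asymptotics.

Section regularization.
Context {R : realType} {X : completeNormedModType R} {N : nat}.
Context {Y : 'I_N -> normedModType R}.
Context (Reg : X -> \bar R) (D : forall i, Y i -> Y i -> \bar R).
(* T_i is encoded by a total function, used on its domain [dom i] only *)
Context (dom : 'I_N -> set X) (T : forall i, X -> Y i).
Context (tauX : topology X) (tauY tauD : forall i, topology (Y i)).

Definition domT : set X := \bigcap_i dom i.

Definition tikhonov (lam : 'I_N -> R) (u : X) (f : forall i, Y i) : \bar R :=
  (\sum_(i < N) (lam i)%:E * D (T i u) (f i) + Reg u)%E.

Definition tikhonov_minimizer lam (f : forall i, Y i) (u : X) :=
  domT u /\ forall v, domT v -> (tikhonov lam u f <= tikhonov lam v f)%E.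

Definition R_minimizing_solution (f : forall i, Y i) (u : X) :=
  [/\ domT u, forall i, T i u = f i, (Reg u < +oo)%E &
      forall v, domT v -> (forall i, T i v = f i) -> (Reg u <= Reg v)%E].

Definition cvg_Di i (a : nat -> Y i) (b : Y i) :=
  D b (a n) @[n --> \oo] --> 0%E /\ cvg_in (tauD i) a b.

Definition cvg_D (f : nat -> forall i, Y i) (g : forall i, Y i) :=
  forall i, @cvg_Di i (fun n => f n i) (g i).

Record assumptionG : Prop := AssumptionG {
  G_definite : forall i (a b : Y i), D a b = 0%E -> a = b;
  G_lsc_D : forall i (a : nat -> Y i) (b : Y i) (f : nat -> Y i) (g : Y i),
    cvg_in (tauY i) a b -> cvg_Di f g ->
    (D b g <= limn_einf (fun n => D (a n) (f n)))%E;
  G_lsc_R : lower_semicontinuous (Reg : topo tauX -> \bar R);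
  G_continuous : forall i,
    {within (dom i : set (topo tauX)),
      continuous (T i : topo tauX -> topo (tauY i))};
  G_closed : forall i (u : nat -> X) (v : X),
    (forall n, dom i (u n)) -> cvg_in tauX u v -> dom i v;
  G_compact : forall (lam : 'I_N -> R) (u : nat -> X)
      (f : nat -> forall i, Y i) (g : forall i, Y i) (c : R),
    (forall i, 0 < lam i) -> (forall n, domT (u n)) -> cvg_D f g ->
    (forall n, (tikhonov lam (u n) (f n) < c%:E)%E) ->
    exists (phi : nat -> nat) (v : X),
      {homo phi : m n / (m < n)%N} /\ cvg_in tauX (u \o phi) v }.

(* Condition S_2(U, f) with prescribed functions psi_i. The value D_i may be
   +oo; products are those of [\bar R], with 0 * +oo = 0. *)
Definition S2 (psi : 'I_N -> R -> R) (U : set X) (f : forall i, Y i) :=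
  U `<=` domT /\
  forall i, modulus (psi i) /\ exists (V : set (Y i)) (alpha : R),
    [/\ tauD i V, V (f i), 0 < alpha &
      forall v, U v -> forall g : Y i, V g -> (D (f i) g < alpha%:E)%E ->
        let p := psi i (fine (D (f i) g)) in
        (D (T i v) g <= D (T i v) (f i) * (1 + p)%:E + p%:E)%E /\
        (D (T i v) (f i) * (1 - p)%:E - p%:E <= D (T i v) g)%E].

Definition subgradient (u : X) (xi : {linear X -> R^o}) :=
  [/\ continuous (xi : X -> R^o), (Reg u < +oo)%E &
      forall v, (Reg u + (xi (v - u))%:E <= Reg v)%E].

(* D_R^xi(v, u), meaningful when R(u) is finite *)
Definition bregman (xi : {linear X -> R^o}) (v u : X) : \bar R :=
  (Reg v - Reg u - (xi (v - u))%:E)%E.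

Definition source_condition (f : forall i, Y i) (udag : X)
    (xi : {linear X -> R^o}) (beta1 beta2 eps : R) :=
  forall u, domT u ->
    (Reg u + \sum_(i < N) D (T i u) (f i) <= Reg udag + eps%:E)%E ->
    ((- xi (u - udag))%:E <= beta1%:E * bregman xi u udag
       + beta2%:E * \sum_(i < N) D (T i u) (T i udag))%E.

End regularization.

Section bounds.
Context {R : realType} {N : nat}.
Context (psi : 'I_N -> R -> R) (delta : 'I_N -> nat -> R).

Definition upper_bound (lam : nat -> 'I_N -> R) (n : nat) : R :=
  \sum_(i < N) (lam n i * delta i n + psi i (delta i n)).

Definition upper_bound_comp (lam : nat -> 'I_N -> R) (j : 'I_N) (n : nat) : R :=
  (lam n j)^-1 * upper_bound lam n.

End bounds.

(* Main.v *)
Require Import Defs.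
From HB Require Import structures.
From mathcomp Require Import all_boot all_order all_algebra.
From mathcomp Require Import all_classical all_reals all_analysis.
From mathcomp Require Import lra.

Set Implicit Arguments.
Unset Strict Implicit.
Unset Printing Implicit Defensive.

Import Order.TTheory GRing.Theory Num.Theory.
Import numFieldNormedType.Exports.

Local Open Scope classical_set_scope.
Local Open Scope ring_scope.

(** Comparing the minimizer [u n] with [udag] in the Tikhonov functional gives
    the single inequality behind all the upper estimates,
    [\sum_i lambda_i * D_i(T_i u, f_i) + R(u)
     <= \sum_i lambda_i * delta_i + R(udag)] ([tikhonov_minimizer_le]).
    The exponents are chosen so that [lambda_i] behaves like
    [delta^(eta_min - mu_i)], hence every [lambda_i * delta_i] behaves like
    [delta^eta_min] ([weight_rate], [weighted_noise_rate]). Dropping the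
    nonnegative discrepancies yields the bound on [R(u n)].

    For the rates, the lower inequality of condition S_2 with [psi_i <= 1/2]
    gives [D_i(T_i u, fdag_i) <= 2 * (D_i(T_i u, f_i) + psi_i(delta_i))]
    ([exact_discrepancy_le]). Since [eta_min < mu_i], the weights tend to
    infinity. This is used twice: the discrepancies of [u n] tend to 0, so that
    [u n] eventually lies in the level set on which the source condition is
    available ([discrepancy_sum_le]); and the discrepancies produced by the
    source condition are absorbed by half of the weighted ones
    ([source_condition_estimate]). What remains is
    [(1 - beta1) * D_R^xi(u, udag) + 1/2 * \sum_i lambda_i * D_i(T_i u, f_i)
     <= \sum_i lambda_i * delta_i + 2 * beta2 * \sum_i psi_i(delta_i)],
    whose right-hand side is O([delta^eta_min]) because
    [psi_i(delta_i)] behaves like [delta^eta_i] and [eta_min <= eta_i]. Dividing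
    the j-th term of the left-hand side by [lambda_j] gives the rate
    [delta^mu_j].

    Optimality needs one term each: [psi_i0(delta_i0)] behaves like
    [delta^eta_min] whatever the weights are, and in the bound for the j-th
    discrepancy the weight [lambda_j] cancels in
    [lambda_j^-1 * (lambda_j * delta_j)] ([upper_bounds_ge]). *)

(** * Comparison of sequences with powers of a null sequence *)

Section asymptotics.
Context {R : realType}.
Implicit Types (x y z : nat -> R) (a e M : R).

(** The real-valued counterpart of [seq_bigO]. *)
Definition eventually_dominated x y :=
  exists2 C, 0 < C & \forall n \near \oo, x n <= C * y n.

Lemma seq_sim_gt0 x y : seq_sim x y -> (forall n, 0 < y n) ->
  forall n, 0 < x n.
Proof.
move=> [c [C [c0 _ xy]]] y0 n; have /andP[+ _] := xy n.
by apply: lt_le_trans; exact: mulr_gt0.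
Qed.

Lemma seq_sim_trans x y z : seq_sim x y -> seq_sim y z -> seq_sim x z.
Proof.
move=> [c [C [c0 C0 xy]]] [d [E [d0 E0 yz]]].
exists (c * d), (C * E); split; [exact: mulr_gt0|exact: mulr_gt0|move=> n].
have /andP[cx xC] := xy n; have /andP[dy yE] := yz n.
rewrite -!mulrA; apply/andP; split.
- by apply: le_trans cx; rewrite ler_pM2l.
- by apply: (le_trans xC); rewrite ler_pM2l.
Qed.

Lemma seq_simM x y x' y' : (forall n, 0 <= y n) -> (forall n, 0 <= y' n) ->
  seq_sim x y -> seq_sim x' y' ->
  seq_sim (fun n => x n * x' n) (fun n => y n * y' n).
Proof.
move=> y0 y'0 [c [C [c0 C0 xy]]] [d [E [d0 E0 xy']]].
exists (c * d), (C * E); split; [exact: mulr_gt0|exact: mulr_gt0|move=> n].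
have /andP[cx xC] := xy n; have /andP[dy yE] := xy' n.
have c_ge0 : 0 <= c * y n by rewrite mulr_ge0// ltW.
have d_ge0 : 0 <= d * y' n by rewrite mulr_ge0// ltW.
by rewrite !(mulrACA _ _ (y n)) !ler_pM// (le_trans _ cx, le_trans _ dy).
Qed.

(** Raising to a negative power reverses inequalities, hence swaps the roles of
    the two comparison constants. *)
Lemma seq_sim_powR a x y : (forall n, 0 < y n) -> seq_sim x y ->
  seq_sim (fun n => x n `^ a) (fun n => y n `^ a).
Proof.
move=> y0 xy; have x0 := seq_sim_gt0 xy y0.
case: xy => [c [C [c0 C0 xy]]].
have le_powR b s t : 0 <= b -> 0 < s -> s <= t -> s `^ b <= t `^ b.
  by move=> b0 s0 st; apply: ge0_ler_powR => //; rewrite nnegrE ltW// (lt_le_trans s0).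
have powM b n k : 0 < k -> k `^ b * y n `^ b = (k * y n) `^ b.
  by move=> k0; rewrite powRM// ltW.
have cy0 n : 0 < c * y n by exact: mulr_gt0.
have [a0|a0] := leP 0 a.
  exists (c `^ a), (C `^ a); split; rewrite ?powR_gt0// => n.
  have /andP[cx xC] := xy n.
  by rewrite !powM// !le_powR.
exists (C `^ a), (c `^ a); split; rewrite ?powR_gt0// => n.
have /andP[cx xC] := xy n.
have Cy0 : 0 < C * y n by exact: mulr_gt0.
rewrite !powM// -[a]opprK !(powRN _ (- a)).
rewrite !lef_pV2 ?posrE ?powR_gt0//.
by rewrite !le_powR ?oppr_ge0 ?(ltW a0).
Qed.

Lemma seq_sim_sim_power psi nu x : sim_power psi nu -> (forall n, 0 <= x n) ->
  seq_sim (fun n => psi (x n)) (fun n => x n `^ nu).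
Proof. by move=> [c [C [c0 C0 psiP]]] x0; exists c, C; split=> // n; exact: psiP. Qed.

Section powers_of_null_sequence.
Variable delta : nat -> R.
Hypotheses (delta_gt0 : forall n, 0 < delta n) (delta_cvg : delta @ \oo --> 0).

Lemma near_powR_le a e : 0 < a -> 0 < e -> \forall n \near \oo, delta n `^ a <= e.
Proof.
move=> a0 e0.
apply: filterS (cvgr_lt 0 delta_cvg _ (powR_gt0 a^-1 e0)) => n d_lt.
have -> : e = (e `^ a^-1) `^ a.
  by rewrite -powRrM mulVf ?gt_eqF// powRr1// ltW.
apply: ge0_ler_powR; rewrite ?nnegrE ?powR_ge0 //.
all: by rewrite ltW.
Qed.

Lemma seq_sim_powR_small x a e : seq_sim x (fun n => delta n `^ a) ->
  0 < a -> 0 < e -> \forall n \near \oo, x n <= e.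
Proof.
move=> [c [C [c0 C0 xd]]] a0 e0.
apply: filterS (near_powR_le a0 (divr_gt0 e0 C0)) => n.
rewrite ler_pdivlMr// mulrC => /(le_trans _); apply.
by have /andP[] := xd n.
Qed.

Lemma seq_sim_powR_large x a M : seq_sim x (fun n => delta n `^ a) ->
  a < 0 -> \forall n \near \oo, M <= x n.
Proof.
move=> [c [C [c0 C0 xd]]] a0.
have M0 : 0 < Num.max 1 M by rewrite lt_max ltr01.
have Na0 : 0 < - a by rewrite oppr_gt0.
apply: filterS (near_powR_le Na0 (divr_gt0 c0 M0)) => n.
rewrite powRN ler_pdivlMr// ler_pdivrMl ?powR_gt0// => M_le.
have /andP[+ _] := xd n; apply: le_trans; rewrite mulrC.
by apply: le_trans M_le; rewrite le_max lexx orbT.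
Qed.

Lemma seq_sim_powR_bounded x a b : seq_sim x (fun n => delta n `^ b) ->
  a <= b -> eventually_dominated x (fun n => delta n `^ a).
Proof.
move=> [c [C [c0 C0 xd]]] ab; exists C => //.
apply: filterS (cvgr_lt 0 delta_cvg _ ltr01) => n d_lt1.
have /andP[_] := xd n; move/le_trans; apply.
by rewrite ler_pM2l// ger_powR// delta_gt0 ltW.
Qed.

End powers_of_null_sequence.

Lemma eventually_dominatedD x y z :
  eventually_dominated x z -> eventually_dominated y z ->
  eventually_dominated (fun n => x n + y n) z.
Proof.
move=> [C C0 xz] [E E0 yz]; exists (C + E); first exact: addr_gt0.
by apply: filterS2 xz yz => n xn yn; rewrite mulrDl lerD.
Qed.

Lemma eventually_dominatedZ k x z : 0 < k ->
  eventually_dominated x z -> eventually_dominated (fun n => k * x n) z.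
Proof.
move=> k0 [C C0 xz]; exists (k * C); first exact: mulr_gt0.
by apply: filterS xz => n; rewrite -mulrA ler_pM2l.
Qed.

Lemma eventually_dominated_sum N (x : 'I_N -> nat -> R) z :
  (forall n, 0 <= z n) -> (forall i, eventually_dominated (x i) z) ->
  eventually_dominated (fun n => \sum_(i < N) x i n) z.
Proof.
move=> z0 xz; elim: N x xz => [|N IH] x xz.
  by exists 1 => //; apply: nearW => n; rewrite big_ord0 mul1r.
under [X in eventually_dominated X]eq_fun do rewrite big_ord_recr /=.
by apply: eventually_dominatedD; [exact: IH|exact: xz].
Qed.

End asymptotics.

(** * Estimates for a fixed noise level *)

Section estimates.
Context {R : realType} {X : completeNormedModType R} {N : nat}.
Context {Y : 'I_N -> normedModType R}.
Context (Reg : X -> \bar R) (D : forall i, Y i -> Y i -> \bar R).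
Context (dom : 'I_N -> set X) (T : forall i, X -> Y i).
Hypothesis Reg_ge0 : forall u, (0 <= Reg u)%E.
Hypothesis D_ge0 : forall i (a b : Y i), (0 <= D a b)%E.

Lemma tikhonov_fin_num lam u (g : forall i, Y i) :
  (forall i, 0 < lam i) -> (tikhonov Reg D T lam u g < +oo)%E ->
  Reg u \is a fin_num /\ forall i, D (T i u) (g i) \is a fin_num.
Proof.
move=> lam0 J_fin.
have term_ge0 i : (0 <= (lam i)%:E * D (T i u) (g i))%E.
  by rewrite mule_ge0// lee_fin ltW.
have sum_ge0 : (0 <= \sum_(i < N) (lam i)%:E * D (T i u) (g i))%E.
  by apply: sume_ge0.
have : tikhonov Reg D T lam u g \is a fin_num.
  by rewrite ge0_fin_numE// adde_ge0.
rewrite fin_numD => /andP[/sum_fin_numP sum_fin Reg_fin]; split=> // i.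
have := sum_fin i (mem_index_enum i) isT.
rewrite !ge0_fin_numE//; case: (D _ _) => // [r _|]; first exact: ltry.
by rewrite gt0_muley// lte_fin.
Qed.

(** The value at a minimizer is at most the value at the exact solution, where
    the discrepancies are the noise levels [d]. This value being finite, all
    the quantities at the minimizer are real numbers, and later estimates take
    place in [R]. *)
Lemma tikhonov_minimizer_le lam (g fdag : forall i, Y i) (d : 'I_N -> R)
    u udag rdag :
  (forall i, 0 < lam i) -> (forall i, (d i)%:E = D (fdag i) (g i)) ->
  tikhonov_minimizer Reg D dom T lam g u ->
  R_minimizing_solution Reg dom T fdag udag -> Reg udag = rdag%:E ->
  exists (b : 'I_N -> R) (r : R),
    [/\ forall i, D (T i u) (g i) = (b i)%:E, forall i, 0 <= b i,
        Reg u = r%:E, 0 <= r &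
        \sum_(i < N) lam i * b i + r <= \sum_(i < N) lam i * d i + rdag].
Proof.
move=> lam0 dE [_ u_min] [udag_dom Tudag _ _] RegE.
have J_le := u_min _ udag_dom.
have J_udag : tikhonov Reg D T lam udag g
    = (\sum_(i < N) lam i * d i + rdag)%:E.
  rewrite /tikhonov RegE EFinD -sumEFin; congr (_ + _)%E.
  by apply: eq_bigr => i _; rewrite Tudag -dE.
have [Reg_fin D_fin] : Reg u \is a fin_num /\
    forall i, D (T i u) (g i) \is a fin_num.
  by apply: tikhonov_fin_num lam0 _; apply: le_lt_trans J_le _; rewrite J_udag ltry.
exists (fun i => fine (D (T i u) (g i))), (fine (Reg u)).
split=> [i|i|||]; rewrite ?fineK ?fine_ge0//.
rewrite -lee_fin -J_udag; apply: le_trans J_le.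
rewrite EFinD fineK// -sumEFin /tikhonov leeD2r//.
by apply: lee_sum => i _; rewrite EFinM fineK.
Qed.

(** The lower inequality of condition S_2 bounds the discrepancy to the exact
    data by the one to the noisy data as soon as the factor [1 - p] is at
    least 1/2; positivity of this factor also excludes an infinite value. *)
Lemma exact_discrepancy_le (a : \bar R) (b p : R) :
  (0 <= a)%E -> 0 <= p <= 2^-1 -> (a * (1 - p)%:E - p%:E <= b%:E)%E ->
  exists2 a' : R, a = a'%:E & 0 <= a' <= 2 * (b + p).
Proof.
move=> + /andP[p0 p1]; case: a => [a| |] //.
  rewrite lee_fin -EFinM -EFinB lee_fin => a0 le_b; exists a => //.
  by rewrite a0 /=; nra.
move=> _; rewrite gt0_mulye ?lte_fin ?subr_gt0; last by lra.
by rewrite addye.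
Qed.

(** Once the weights dominate [4 * beta2], the discrepancies entering the
    source condition are absorbed by half of the discrepancy terms of the
    functional: [beta2 * a_i <= 2 * beta2 * b_i + 2 * beta2 * p_i] and
    [2 * beta2 * b_i <= lam_i * b_i / 2]. Here [a_i] and [b_i] are the
    discrepancies to the exact and to the noisy data, and [L] is the weighted
    noise. *)
Lemma source_condition_estimate lam (fdag : forall i, Y i) (a b p : 'I_N -> R)
    (L r rdag beta1 beta2 e : R) (xi : {linear X -> R^o}) u udag :
  (forall i, 4 * beta2 <= lam i) ->
  domT dom u -> (forall i, T i udag = fdag i) ->
  Reg u = r%:E -> Reg udag = rdag%:E ->
  (forall i, D (T i u) (fdag i) = (a i)%:E) -> (forall i, 0 <= b i) ->
  (forall i, a i <= 2 * (b i + p i)) ->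
  \sum_(i < N) lam i * b i + r <= L + rdag ->
  r + \sum_(i < N) a i <= rdag + e ->
  0 < beta2 ->
  subgradient Reg udag xi ->
  source_condition Reg D dom T fdag udag xi beta1 beta2 e ->
  exists2 d : R, bregman Reg xi u udag = d%:E &
    0 <= d /\ (1 - beta1) * d + 2^-1 * \sum_(i < N) lam i * b i
      <= L + 2 * beta2 * \sum_(i < N) p i.
Proof.
move=> lam_ge u_dom Tudag RuE RudagE DE b0 a_le value_le near_level beta2_gt0.
move=> [_ _ /(_ u) xi_sub] /(_ u u_dom).
have sum_aE : (\sum_(i < N) D (T i u) (fdag i) = (\sum_(i < N) a i)%:E)%E.
  by rewrite -sumEFin; apply: eq_bigr => i _; rewrite DE.
have sum_aE' : (\sum_(i < N) D (T i u) (T i udag) = (\sum_(i < N) a i)%:E)%E.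
  by rewrite -sum_aE; apply: eq_bigr => i _; rewrite Tudag.
rewrite /bregman sum_aE sum_aE' RuE RudagE -!EFinD !lee_fin => /(_ near_level) source.
move: xi_sub; rewrite RuE RudagE -EFinD lee_fin => xi_sub.
exists (r - rdag - xi (u - udag)) => //; split; first by lra.
have sum_a : \sum_(i < N) a i <= 2 * \sum_(i < N) b i + 2 * \sum_(i < N) p i.
  rewrite -mulrDr -big_split mulr_sumr /=.
  by apply: ler_sum => i _; exact: a_le.
have sum_b : 4 * beta2 * \sum_(i < N) b i <= \sum_(i < N) lam i * b i.
  by rewrite mulr_sumr; apply: ler_sum => i _; rewrite ler_wpM2r.
have := ler_wpM2l (ltW beta2_gt0) sum_a.
move: sum_b source value_le; lra.
Qed.

End estimates.

(** * Convergence rates *)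

Section noisy_data.
Context {R : realType} {X : completeNormedModType R} {N : nat}.
Context {Y : 'I_N -> normedModType R}.
Context (D : forall i, Y i -> Y i -> \bar R).
Context (dom : 'I_N -> set X) (T : forall i, X -> Y i).
Context (tauD : forall i, topology (Y i)).

(** Convergence of the noisy data brings them into the neighbourhoods on which
    condition S_2 applies, from a rank that is the same for all [v] in [U]. *)
Lemma S2_eventually psi U (f : nat -> forall i, Y i) (fdag : forall i, Y i)
    (d : 'I_N -> nat -> R) :
  S2 D dom T tauD psi U fdag -> cvg_D D tauD f fdag ->
  (forall i n, (d i n)%:E = D (fdag i) (f n i)) ->
  \forall n \near \oo, forall i v, U v ->
    (D (T i v) (fdag i) * (1 - psi i (d i n))%:E - (psi i (d i n))%:E
     <= D (T i v) (f n i))%E.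
Proof.
move=> [_ S2U] f_cvg dE; apply: filter_forall => i.
have [_ [V [alpha [Vopen Vf alpha0 ineq]]]] := S2U i.
have [D_cvg tau_cvg] := f_cvg i.
have V_near : \forall n \near \oo, V (f n i).
  by apply: (tau_cvg V); apply: (@open_nbhs_nbhs (topo (tauD i))).
have d_lt : \forall n \near \oo, d i n < alpha.
  have /fine_cvgP[_ fine_cvg] := D_cvg.
  apply: filterS (cvgr_lt 0 fine_cvg _ alpha0) => n /=.
  by rewrite -dE.
apply: filterS2 V_near d_lt => n Vn dn v Uv.
have D_lt : (D (fdag i) (f n i) < alpha%:E)%E by rewrite -dE lte_fin.
by have [_] := ineq v Uv _ Vn D_lt; rewrite -dE.
Qed.

End noisy_data.

Section rates.
Context {R : realType} {N : nat}.
Implicit Types (lam a b p : 'I_N -> R).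

(** Large weights force small discrepancies: each weighted discrepancy is at
    most the total budget [M], and [lam i] is at least [M] divided by
    [e / (4 * N.+1)], so both [b i] and [p i] are at most [e / (4 * N.+1)].
    Taking [N.+1] makes this quotient meaningful for every [N]. *)
Lemma discrepancy_sum_le lam a b p (M e : R) :
  0 < e -> (forall i, 0 < lam i) -> (forall i, 0 <= b i) ->
  \sum_(i < N) lam i * b i <= M ->
  (forall i, a i <= 2 * (b i + p i)) ->
  (forall i, p i <= e / (4 * N.+1%:R)) ->
  (forall i, M / (e / (4 * N.+1%:R)) <= lam i) ->
  \sum_(i < N) a i <= e.
Proof.
move=> e0 lam0 b0 sum_le a_le p_le lam_ge.
set k := e / (4 * N.+1%:R) in p_le lam_ge.
have k0 : 0 < k by rewrite divr_gt0// mulr_gt0// ltr0n.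
have b_le i : b i <= k.
  rewrite -(ler_pM2l (lam0 i)); apply: (@le_trans _ _ M).
    apply: le_trans sum_le; rewrite (bigD1 i)//= lerDl sumr_ge0// => j _.
    by rewrite mulr_ge0// ltW.
  by rewrite -ler_pdivrMr.
have a_le4k i : a i <= 4 * k.
  by have := a_le i; have := b_le i; have := p_le i; lra.
apply: (@le_trans _ _ (\sum_(i < N) 4 * k)).
  by apply: ler_sum => i _.
have kE : 4 * k * N.+1%:R = e.
  by rewrite [4 * k]mulrC -mulrA divfK// mulf_neq0 ?pnatr_eq0.
by rewrite sumr_const card_ord -[_ *+ N]mulr_natr -[leRHS]kE ler_pM2l ?mulr_gt0// ler_nat.
Qed.

Context (delta : nat -> R) (delta_ : 'I_N -> nat -> R) (mu : 'I_N -> R).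
Context (eta_min : R).
Context (delta_gt0 : forall n, 0 < delta n).
Context (delta_sim : forall i, seq_sim (delta_ i) (fun n => delta n `^ mu i)).

Lemma component_noise_gt0 i n : 0 < delta_ i n.
Proof.
by apply: (seq_sim_gt0 (delta_sim i)) => m; rewrite powR_gt0.
Qed.

Lemma component_noise_powR i s :
  seq_sim (fun n => delta_ i n `^ s) (fun n => delta n `^ (mu i * s)).
Proof.
have -> : (fun n => delta n `^ (mu i * s)) = (fun n => (delta n `^ mu i) `^ s).
  by apply/funext => n; rewrite powRrM.
by apply: seq_sim_powR (delta_sim i) => n; rewrite powR_gt0.
Qed.

(** The exponents [eps_i = eta_min / mu_i] are chosen for this: the rate of the
    weight turns [lambda_i * delta_i] into [delta^eta_min] for every [i]. *)
Lemma weight_rate i (lam : nat -> R) : mu i != 0 ->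
  seq_sim lam (fun n => delta_ i n `^ (- (1 - eta_min / mu i))) ->
  seq_sim lam (fun n => delta n `^ (eta_min - mu i)).
Proof.
move=> mu0 /seq_sim_trans; apply.
have -> : eta_min - mu i = mu i * - (1 - eta_min / mu i).
  by rewrite opprB mulrBr mulr1 mulrC divfK.
exact: component_noise_powR.
Qed.

Lemma weighted_noise_rate i (lam : nat -> R) :
  seq_sim lam (fun n => delta n `^ (eta_min - mu i)) ->
  seq_sim (fun n => lam n * delta_ i n) (fun n => delta n `^ eta_min).
Proof.
move=> lam_sim.
have -> : (fun n => delta n `^ eta_min) =
    (fun n => delta n `^ (eta_min - mu i) * delta n `^ mu i).
  apply/funext => n; rewrite -powRD ?subrK//.
  by apply/implyP => _; rewrite gt_eqF.
by apply: seq_simM => // n; exact: powR_ge0.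
Qed.

(** This holds for all positive weights: the first bound keeps the term
    [psi_i0(delta_i0)], the second one the term [lam_j * delta_j]. *)
Lemma upper_bounds_ge (psi : 'I_N -> R -> R) (lam : nat -> 'I_N -> R) (i0 : 'I_N) :
  (forall i n, 0 <= psi i (delta_ i n)) -> (forall n i, 0 < lam n i) ->
  seq_sim (fun n => psi i0 (delta_ i0 n)) (fun n => delta n `^ eta_min) ->
  exists2 c : R, 0 < c &
    forall n,
      c * delta n `^ eta_min <= upper_bound psi delta_ lam n /\
      forall j, c * delta n `^ mu j <= upper_bound_comp psi delta_ lam j n.
Proof.
move=> psi_ge0 lam_gt0 [c [C [c0 _ psi_c]]].
have delta__ge0 i n : 0 <= delta_ i n by rewrite ltW// component_noise_gt0.
have noise_ge0 n i : 0 <= lam n i * delta_ i n by rewrite mulr_ge0// ltW.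
have term_ge0 n i : 0 <= lam n i * delta_ i n + psi i (delta_ i n).
  by rewrite addr_ge0.
have term_le n i :
    lam n i * delta_ i n + psi i (delta_ i n) <= upper_bound psi delta_ lam n.
  by rewrite /upper_bound (bigD1 i)//= lerDl sumr_ge0.
have [cs csP] := choice delta_sim.
pose cmin := \big[Num.min/c]_(i < N) cs i.
exists cmin; first by apply/bigmin_gtP; split=> // i _; have [C' []] := csP i.
move=> n; split=> [|j].
  apply: (@le_trans _ _ (c * delta n `^ eta_min)).
    by rewrite ler_wpM2r ?powR_ge0// bigmin_le_id.
  apply: le_trans (term_le n i0); have /andP[psi_ge _] := psi_c n.
  by apply: le_trans psi_ge _; rewrite lerDr.
have [C' [_ _ /(_ n) /andP[d_ge _]]] := csP j.
apply: (@le_trans _ _ (cs j * delta n `^ mu j)).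
  by rewrite ler_wpM2r ?powR_ge0// bigmin_le_cond.
apply: (le_trans d_ge); rewrite /upper_bound_comp ler_pdivlMl//.
by apply: le_trans (term_le n j); rewrite lerDl.
Qed.

End rates.

(** A component with [mu_i = eta_min] would have [nu_i = 1] and attain the
    minimum [eta_min] with an exponent smaller than [mu_i0], because
    [eta_min = mu_i0 * nu_i0 < mu_i0]. *)
Lemma eta_min_lt_mu (R : realType) (I : Type) (mu nu eta : I -> R) (eta_min : R)
    (i0 : I) :
  (forall i, 0 < mu i) -> (forall i, 0 < nu i <= 1) ->
  (forall i, eta i = mu i * nu i) -> is_minimum (range eta) eta_min ->
  eta i0 = eta_min ->
  is_minimum (mu @` [set i | eta i = eta_min]) (mu i0) -> nu i0 < 1 ->
  forall i, 0 < eta_min < mu i.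
Proof.
move=> mu0 nu01 etaE [_ eta_le] eta_i0 [_ mu_le] nu_i0 i.
have /andP[nu0 nu1] := nu01 i.
have eta0 : 0 < eta_min.
  by rewrite -eta_i0 etaE mulr_gt0//; have /andP[] := nu01 i0.
have le_i : eta_min <= mu i * nu i by rewrite -etaE; apply: eta_le; exists i.
have le_mu : mu i * nu i <= mu i by rewrite ler_piMr// ltW.
rewrite eta0 /= lt_neqAle (le_trans le_i le_mu) andbT; apply/eqP => eta_mu.
have eta_i : eta i = eta_min.
  by apply/eqP; rewrite etaE eq_le le_i eta_mu le_mu.
have : mu i0 <= mu i by apply: mu_le; exists i.
by rewrite -eta_mu -eta_i0 etaE leNgt gtr_pMr// nu_i0.
Qed.

Theorem corollary2p15 (R : realType) (X : completeNormedModType R)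
  (Reg : X -> \bar R) (Reg_ge0 : forall u, (0 <= Reg u)%E)
  (N : nat) (Y : 'I_N -> normedModType R)
  (D : forall i, Y i -> Y i -> \bar R)
  (D_ge0 : forall i (a b : Y i), (0 <= D i a b)%E)
  (dom : 'I_N -> set X) (T : forall i, X -> Y i)
  (tauX : topology X) (tauY tauD : forall i, topology (Y i))
  (tauX_T2 : hausdorff_space (topo tauX))
  (tauY_T2 : forall i, hausdorff_space (topo (tauY i)))
  (HG : assumptionG Reg D dom T tauX tauY tauD)
  (f : nat -> forall i, Y i) (fdag : forall i, Y i)
  (f_cvg : cvg_D D tauD f fdag)
  (delta_ : 'I_N -> nat -> R)
  (delta_E : forall i n, (delta_ i n)%:E = D i (fdag i) (f n i))
  (delta : nat -> R) (delta_gt0 : forall n, 0 < delta n)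
  (delta_cvg : delta @ \oo --> 0)
  (mu : 'I_N -> R) (mu_ge1 : forall i, 1 <= mu i)
  (delta_sim : forall i, seq_sim (delta_ i) (fun n => delta n `^ mu i))
  (nu : 'I_N -> R) (nu_bound : forall i, 0 < nu i <= 1)
  (eta : 'I_N -> R) (etaE : forall i, eta i = mu i * nu i)
  (eta_min : R) (eta_minE : is_minimum (range eta) eta_min)
  (i0 : 'I_N) (eta_i0 : eta i0 = eta_min)
  (mu_i0 : is_minimum (mu @` [set i | eta i = eta_min]) (mu i0))
  (nu_i0 : nu i0 < 1)
  (eps : 'I_N -> R) (epsE : forall i, eps i = eta_min / mu i) :
  (forall i, 0 < eps i < 1) /\
  forall (lam : nat -> 'I_N -> R)
    (lam_gt0 : forall n i, 0 < lam n i)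
    (lam_sim : forall i,
      seq_sim (fun n => lam n i) (fun n => delta_ i n `^ (- (1 - eps i))))
    (u : nat -> X)
    (u_min : forall n, tikhonov_minimizer Reg D dom T (lam n) (f n) (u n))
    (udag : X) (udag_sol : R_minimizing_solution Reg dom T fdag udag)
    (psi : 'I_N -> R -> R) (n0 : nat)
    (HS2 : S2 D dom T tauD psi
      ([set u n | n in [set n | (n0 <= n)%N]] `|` [set udag]) fdag)
    (psi_sim : forall i, sim_power (psi i) (nu i)),
  [/\ exists2 C : R, 0 < C &
        \forall n \near \oo,
          (Reg (u n) <= Reg udag + (C * delta n `^ eta_min)%:E)%E,
      forall (xi : {linear X -> R^o}) (beta1 beta2 e : R),
        subgradient Reg udag xi ->
        0 < beta1 < 1 -> 0 < beta2 -> 0 < e ->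
        source_condition Reg D dom T fdag udag xi beta1 beta2 e ->
        forall j,
          seq_bigO (fun n => bregman Reg xi (u n) udag)
               (fun n => delta n `^ eta_min) /\
          seq_bigO (fun n => D j (T j (u n)) (f n j))
               (fun n => delta n `^ mu j) &
      forall (eps' : 'I_N -> R) (lam' : nat -> 'I_N -> R),
        (forall i, 0 < eps' i < 1) ->
        (forall n i, lam' n i = delta_ i n `^ (- (1 - eps' i))) ->
        exists2 c : R, 0 < c &
          forall n,
            c * delta n `^ eta_min <= upper_bound psi delta_ lam' n /\
            forall j, c * delta n `^ mu j <= upper_bound_comp psi delta_ lam' j n].
Proof.
have mu_gt0 i : 0 < mu i by exact: lt_le_trans ltr01 (mu_ge1 i).
have eta_mu := eta_min_lt_mu mu_gt0 nu_bound etaE eta_minE eta_i0 mu_i0 nu_i0.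
have eta_gt0 : 0 < eta_min by have /andP[] := eta_mu i0.
have eta_lt i : eta_min < mu i by have /andP[] := eta_mu i.
split=> [i|lam lam_gt0 lam_sim u u_min udag udag_sol psi n0 HS2 psi_sim].
  by rewrite epsE divr_gt0//= ltr_pdivrMr// mul1r.
have delta__gt0 := component_noise_gt0 delta_gt0 delta_sim.
have lam_rate i : seq_sim (lam ^~ i) (fun n => delta n `^ (eta_min - mu i)).
  apply: (weight_rate delta_gt0 delta_sim); first by rewrite gt_eqF.
  by rewrite -epsE; exact: lam_sim.
have psi_rate i :
    seq_sim (fun n => psi i (delta_ i n)) (fun n => delta n `^ eta i).
  have := seq_sim_sim_power (psi_sim i) (fun n => ltW (delta__gt0 i n)).
  move=> /seq_sim_trans; apply; rewrite etaE.
  exact: component_noise_powR.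
have psi_ge0 i n : 0 <= psi i (delta_ i n).
  by rewrite ltW// (seq_sim_gt0 (psi_rate i))// => m; rewrite powR_gt0.
pose L n := \sum_(i < N) lam n i * delta_ i n.
have L_dom : eventually_dominated L (fun n => delta n `^ eta_min).
  apply: eventually_dominated_sum => [n|i]; first exact: powR_ge0.
  apply: (seq_sim_powR_bounded delta_gt0 delta_cvg) (lexx eta_min).
  exact: (weighted_noise_rate delta_gt0 delta_sim (lam_rate i)).
have [udag_dom Tudag Reg_udag_fin _] := udag_sol.
have [rdag RudagE] : exists r, Reg udag = r%:E.
  by exists (fine (Reg udag)); rewrite fineK// ge0_fin_numE.
have value_le n := tikhonov_minimizer_le Reg_ge0 D_ge0 (lam_gt0 n)
  (fun i => delta_E i n) (u_min n) udag_sol RudagE.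
split.
- have [C C0 L_le] := L_dom; exists C => //.
  apply: filterS L_le => n L_le.
  have [b [r [_ b0 -> _ r_le]]] := value_le n.
  rewrite RudagE -EFinD lee_fin.
  have : 0 <= \sum_(i < N) lam n i * b i.
    by apply: sumr_ge0 => i _; rewrite mulr_ge0// ltW.
  by move: r_le L_le; rewrite -/(L n); lra.
- move=> xi beta1 beta2 e xi_sub /andP[beta1_gt0 beta1_lt1] beta2_gt0 e_gt0 src j.
  pose P n := \sum_(i < N) psi i (delta_ i n).
  have [K K0 K_le] : eventually_dominated (fun n => L n + 2 * beta2 * P n)
      (fun n => delta n `^ eta_min).
    apply: eventually_dominatedD => //.
    apply: eventually_dominatedZ; first by rewrite mulr_gt0.
    apply: eventually_dominated_sum => [n|i]; first exact: powR_ge0.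
    apply: (seq_sim_powR_bounded delta_gt0 delta_cvg) (psi_rate i) _.
    by apply: eta_minE.2; exists i.
  (* The excess [e] is split into [e / 2] for the weighted noise and [e / 2]
     for the discrepancies. *)
  have e4_gt0 : 0 < e / 2 / (4 * N.+1%:R).
    by rewrite !divr_gt0// mulr_gt0// ltr0n.
  have psi_small k : 0 < k ->
      \forall n \near \oo, forall i, psi i (delta_ i n) <= k.
    move=> k0; apply: filter_forall => i.
    apply: (seq_sim_powR_small delta_gt0 delta_cvg (psi_rate i)) => //.
    by rewrite (lt_le_trans eta_gt0)//; apply: eta_minE.2; exists i.
  have lam_large M : \forall n \near \oo, forall i, M <= lam n i.
    apply: filter_forall => i.
    apply: (seq_sim_powR_large delta_gt0 delta_cvg _ (lam_rate i)).
    by rewrite subr_lt0.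
  have L_small : \forall n \near \oo, L n <= e / 2.
    have [C C0 L_le] := L_dom.
    have eC : 0 < e / 2 / C by rewrite !divr_gt0.
    apply: filterS2 L_le (near_powR_le delta_gt0 delta_cvg eta_gt0 eC) => n.
    by rewrite ler_pdivlMr// mulrC => /le_trans; apply.
  have estimate : \forall n \near \oo, exists (b : 'I_N -> R) (d : R),
      [/\ forall i, D i (T i (u n)) (f n i) = (b i)%:E, forall i, 0 <= b i,
          bregman Reg xi (u n) udag = d%:E, 0 <= d &
          (1 - beta1) * d + 2^-1 * \sum_(i < N) lam n i * b i
            <= K * delta n `^ eta_min].
    have n0_le : \forall n \near \oo, (n0 <= n)%N by exact: nbhs_infty_ge.
    have half_gt0 : (0 : R) < 2^-1 by rewrite invr_gt0.
    apply: filterS (filterI (filterI n0_le (S2_eventually HS2 f_cvg delta_E))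
      (filterI (filterI (psi_small _ half_gt0) (psi_small _ e4_gt0))
        (filterI (filterI (lam_large (4 * beta2)) K_le)
          (filterI L_small
            (lam_large ((e / 2 + rdag) / (e / 2 / (4 * N.+1%:R)))))))).
    move=> n [[n0n S2n] [[psi_half psi_e] [[lam_beta2 K_n] [L_n lam_e]]]].
    have [b [r [DE b0 RuE r0 r_le]]] := value_le n.
    rewrite -/(L n) in r_le.
    have a_ex i : exists a, D i (T i (u n)) (fdag i) = a%:E /\
        a <= 2 * (b i + psi i (delta_ i n)).
      have := S2n i (u n) (or_introl (ex_intro2 _ _ n n0n erefl)); rewrite DE.
      have psi_01 : 0 <= psi i (delta_ i n) <= 2^-1 by rewrite psi_ge0 psi_half.
      move=> /(exact_discrepancy_le (D_ge0 _ _ _) psi_01)[a -> /andP[_ a_le]].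
      by exists a.
    have [a aP] := choice a_ex.
    have sum_le : \sum_(i < N) lam n i * b i <= e / 2 + rdag by lra.
    have sum_ge0 : 0 <= \sum_(i < N) lam n i * b i.
      by apply: sumr_ge0 => i _; rewrite mulr_ge0// ltW.
    have sum_a_le : \sum_(i < N) a i <= e / 2.
      apply: (discrepancy_sum_le _ (lam_gt0 n) b0 sum_le (fun i => (aP i).2)) => //.
      by rewrite divr_gt0.
    have near_level : r + \sum_(i < N) a i <= rdag + e by lra.
    have [d dE [d0 d_le]] := source_condition_estimate lam_beta2 (proj1 (u_min n))
      Tudag RuE RudagE (fun i => (aP i).1) b0 (fun i => (aP i).2) r_le
      near_level beta2_gt0 xi_sub src.
    by exists b, d; split=> //; exact: le_trans d_le K_n.
  split.
    exists (K / (1 - beta1)); first by rewrite divr_gt0// subr_gt0.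
    apply: filterS estimate => n [b [d [_ b0 -> d0 d_le]]].
    rewrite lee_fin mulrAC ler_pdivlMr ?subr_gt0// mulrC.
    apply: le_trans d_le; rewrite lerDl mulr_ge0// sumr_ge0// => i _.
    by rewrite mulr_ge0// ltW.
  (* [lambda_j * D_j] is O([delta^eta_min]) and [lambda_j >= c * delta^(eta_min -
     mu_j)], which leaves [delta^mu_j] for [D_j]. *)
  have [c [C [c0 C0 lam_c]]] := lam_rate j.
  exists (2 * K / c); first by rewrite divr_gt0// mulr_gt0.
  apply: filterS estimate => n [b [d [-> b0 _ d0 d_le]]].
  rewrite lee_fin.
  have /andP[lam_ge _] := lam_c n.
  have rate_gt0 : 0 < delta n `^ (eta_min - mu j) by exact: powR_gt0.
  have rateE : delta n `^ eta_min = delta n `^ (eta_min - mu j) * delta n `^ mu j.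
    rewrite -powRD ?subrK//.
    by apply/implyP => _; rewrite gt_eqF.
  have term_le : lam n j * b j <= \sum_(i < N) lam n i * b i.
    rewrite (bigD1 j)//= lerDl sumr_ge0// => i _.
    by rewrite mulr_ge0// ltW.
  have d_term : 0 <= (1 - beta1) * d by rewrite mulr_ge0// subr_ge0 ltW.
  rewrite mulrAC ler_pdivlMr// -(ler_pM2l rate_gt0).
  have cb_le : c * delta n `^ (eta_min - mu j) * b j <= lam n j * b j.
    by rewrite ler_wpM2r.
  by move: d_le; rewrite rateE; lra.
- move=> eps' lam' _ lam'E.
  apply: (upper_bounds_ge delta_gt0 delta_sim (i0 := i0)) => // [n i|].
    by rewrite lam'E powR_gt0.
  by rewrite -eta_i0; exact: psi_rate.
Qed.
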